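(* For all integers $n\ge1$ and all $j=1,\dots,2^n-1$, the denominator of $w_{n,j}(z)$ equals the numerator of $w_{n,j+1}(z)$.
   Context: Let $\mathbb{N}_0=\{0,1,2,\dots\}$ and let $z$ be a variable. A positive linear fractional transformation is an expression $w=\frac{az+b}{cz+d}$ with $a,b,c,d\in\mathbb{N}_0$ and $ad-bc\neq0$. Its numerator is $az+b$ and its denominator is $cz+d$. Define $\frac{w}{w+1}:=\frac{az+b}{(a+c)z+(b+d)}$ and $w+1:=\frac{(a+c)z+(b+d)}{cz+d}$. The rows are defined recursively. Row $0$ is $(w_{0,1})=(z)$, with $z=\frac{1z+0}{0z+1}$. For $n\ge1$, row $n$ is $(w_{n,1}(z),\dots,w_{n,2^n}(z))$, with $w_{n,2i-1}=\frac{w_{n-1,i}}{w_{n-1,i}+1}$ and $w_{n,2i}=w_{n-1,i}+1$ for $i=1,\dots,2^{n-1}$. *)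

(* Defs.v *)
From HB Require Import structures.
From mathcomp Require Import all_boot all_order all_algebra.

Set Implicit Arguments.
Unset Strict Implicit.
Unset Printing Implicit Defensive.

Import GRing.Theory.
Local Open Scope ring_scope.

(* A positive linear fractional transformation is the formal expression
   (a z + b) / (c z + d), not the rational function it denotes: numerator and
   denominator are read off the coefficients, without any cancellation. *)
Record plft : Type := Plft {
  coef_a : nat;
  coef_b : nat;
  coef_c : nat;
  coef_d : nat;
  plft_det : coef_a%:Z * coef_d%:Z - coef_b%:Z * coef_c%:Z != 0
}.

(* The variable z is the polynomial variable 'X. *)
Definition numerator (w : plft) : {poly int} :=
  (coef_a w)%:Z *: 'X + (coef_b w)%:Z%:P.

Definition denominator (w : plft) : {poly int} :=
  (coef_c w)%:Z *: 'X + (coef_d w)%:Z%:P.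

Fact plft_z_det : 1%N%:Z * 1%N%:Z - 0%N%:Z * 0%N%:Z != 0.
Proof. by []. Qed.

Definition plft_z : plft := @Plft 1 0 0 1 plft_z_det.

Fact left_child_det (w : plft) :
  (coef_a w)%:Z * (coef_b w + coef_d w)%N%:Z
    - (coef_b w)%:Z * (coef_a w + coef_c w)%N%:Z != 0.
Proof.
case: w => a b c d /= Hdet.
by rewrite !PoszD !mulrDr (mulrC b%:Z a%:Z) opprD addrACA subrr add0r.
Qed.

(* w / (w + 1) *)
Definition left_child (w : plft) : plft :=
  @Plft (coef_a w) (coef_b w) (coef_a w + coef_c w) (coef_b w + coef_d w)
    (left_child_det w).

Fact right_child_det (w : plft) :
  (coef_a w + coef_c w)%N%:Z * (coef_d w)%:Z
    - (coef_b w + coef_d w)%N%:Z * (coef_c w)%:Z != 0.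
Proof.
case: w => a b c d /= Hdet.
by rewrite !PoszD !mulrDl (mulrC d%:Z c%:Z) opprD addrACA subrr addr0.
Qed.

(* w + 1 *)
Definition right_child (w : plft) : plft :=
  @Plft (coef_a w + coef_c w) (coef_b w + coef_d w) (coef_c w) (coef_d w)
    (right_child_det w).

(* [w_ n j] is w_{n,j} with j counted from 1; it is meaningful only for
   1 <= j <= 2 ^ n. Both j = 2 i - 1 and j = 2 i give uphalf j = i, see
   [w_odd] and [w_even]. *)
Fixpoint w_ (n j : nat) : plft :=
  if n is m.+1 then
    if odd j then left_child (w_ m (uphalf j)) else right_child (w_ m (uphalf j))
  else plft_z.

Lemma w_odd (n i : nat) :
  (0 < i)%N -> w_ n.+1 (2 * i - 1) = left_child (w_ n i).
Proof.
case: i => // i _; rewrite mul2n doubleS subn1 /= odd_double /=.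
by rewrite doubleK.
Qed.

Lemma w_even (n i : nat) : w_ n.+1 (2 * i) = right_child (w_ n i).
Proof. by rewrite mul2n /= odd_double uphalf_double. Qed.

(* Main.v *)
Require Import Defs.
From HB Require Import structures.
From mathcomp Require Import all_boot all_order all_algebra.

(* The two children of [w] share the linear form numerator + denominator,
   which is the denominator of the left one and the numerator of the right one;
   a right child keeps the denominator of its parent and a left child keeps the
   numerator, so at the boundary between two families the claim is inherited
   from the previous row. *)
Lemma coef_cd_w_succ (n j : nat) :
    0 < j < 2 ^ n ->
  coef_c (w_ n j) = coef_a (w_ n j.+1) /\ coef_d (w_ n j) = coef_b (w_ n j.+1).
Proof.
elim: n j => [|n IHn] j; first by case: j.
case/andP=> j_gt0 j_lt; rewrite -(odd_double_half j) in j_gt0 j_lt *.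
case: (odd j) j_gt0 j_lt => /=; rewrite ?add1n ?add0n => j_gt0 j_lt.
  (* With [k = j./2], odd [j]: positions [j] and [j.+1] hold the two children of [w_ n k.+1]. *)
  by rewrite /= odd_double /= uphalf_double doubleK.
(* Even [j]: the right child of [w_ n k] meets the left child of [w_ n k.+1], and the bounds on [j]
   halve to [0 < k < 2 ^ n]. *)
rewrite /= odd_double /= uphalf_double doubleK; apply: IHn.
by rewrite -double_gt0 j_gt0 -ltn_double -[(2 ^ n).*2]mul2n -expnS.
Qed.

Theorem mainTheorem4 (n j : nat) (hn : (1 <= n)%N)
    (hj : (1 <= j <= 2 ^ n - 1)%N) :
  denominator (w_ n j) = numerator (w_ n (j + 1)).
Proof.
have /coef_cd_w_succ[c_a d_b] : 0 < j < 2 ^ n.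
  (* Subtraction on [nat] truncates, so [2 ^ n > 0] is what makes [2 ^ n - 1] a true predecessor. *)
  by case/andP: hj => -> /=; rewrite subn1 -ltnS prednK // expn_gt0.
by rewrite addn1 /denominator /numerator c_a d_b.
Qed.
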